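(* Let $P$ be a convex polygon with $n\ge 5$ vertices in the affine plane $\mathbb{R}^2$. Then the following three conditions are equivalent: (1) All successive images $S(P), S^2(P), S^3(P),\dots$ of $P$ under the inverse pentagram map $S$ are convex polygons in the affine plane. (2) The vector $d_P := \sum_{i=1}^n \frac{d_i}{\mathcal A_i}\in\mathbb{R}^2$ is zero. (3) Glick's operator $G_P\colon\mathbb{R}^3\to\mathbb{R}^3$, regarded as a projective mapping of $\mathbb{P}^2$, is affine.
   Context: The affine plane $\mathbb{R}^2$ is regarded as the chart $\{z\ne 0\}$ of the real projective plane $\mathbb{P}^2=\mathbb{P}(\mathbb{R}^3)$ with homogeneous coordinates $(x,y,z)$; the line at infinity is $\{z=0\}$. A polygon ($n$-gon) is a cyclic sequence of points (vertices) $p_i$, $i\in\mathbb{Z}/n$, in $\mathbb{P}^2$; its sides are the lines $p_ip_{i+1}$. A polygon is convex (in the affine plane) if all its vertices lie in the affine plane and for each $i$ all vertices other than $p_i,p_{i+1}$ lie strictly on one side of the line $p_ip_{i+1}$. Inverse pentagram map: $S(P)$ is the polygon whose vertices are the intersection points of second nearest sides of $P$; i.e. with $\ell_i=p_ip_{i+1}$, the vertices of $S(P)$ are, in cyclic order, $\ell_{i-1}\cap\ell_{i+1}$ (points of $\mathbb{P}^2$; they may be at infinity). For a convex polygon $P$ with at least five vertices all iterates $S^k(P)$ are well-defined polygons in $\mathbb{P}^2$. For a convex $n$-gon $P$ in the affine plane, $d_i$ denotes the vector from vertex $p_{i-1}$ to vertex $p_{i+1}$, and $\mathcal A_i>0$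 denotes the area of the triangle with vertices $p_{i-1},p_i,p_{i+1}$. Glick's operator: let $v_i\in\mathbb{R}^3$ be a vector of homogeneous coordinates of the $i$-th vertex of $P$. Then $$G_P(v) := n v - \sum_{i=1}^n \frac{v_{i-1}\wedge v \wedge v_{i+1}}{v_{i-1}\wedge v_i \wedge v_{i+1}}\,v_i ,$$ where the ratio of elements of the one-dimensional space $\Lambda^3\mathbb{R}^3$ is a number (a ratio of $3\times 3$ determinants); this does not depend on the rescaling of the $v_i$. A linear operator on $\mathbb{R}^3$ regarded as a projective mapping is called affine if it preserves the line at infinity, in the sense that the preimage of the line at infinity is the line at infinity, i.e. the $z$-coordinate of the image of $(x,y,z)$ equals $cz$ for a constant $c\neq0$. *)

(* Defs.v *)
From HB Require Import structures.
From mathcomp Require Import all_boot all_order all_algebra.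
From mathcomp Require Import reals.

Set Implicit Arguments.
Unset Strict Implicit.
Unset Printing Implicit Defensive.

Import Order.TTheory GRing.Theory Num.Theory.
Local Open Scope ring_scope.

(* Vertices are indexed by 'I_n read as Z/n: [ordS i] is i + 1 and            *)
(* [ord_pred i] is i - 1, both modulo n.                                      *)

Section AffinePolygons.
Variables (R : realType) (n : nat).
Implicit Types (a b c : 'rV[R]_2) (p : 'I_n -> 'rV[R]_2).

(* Twice the signed area of the triangle abc. Its sign tells on which side    *)
(* of the line ab the point c lies; it vanishes iff a, b, c are collinear.    *)
Definition orient a b c : R := \det (col_mx (b - a) (c - a) : 'M[R]_2).

Definition triangle_area a b c : R := `|orient a b c| / 2.

Definition convex_polygon p : Prop := forall i : 'I_n,
     (forall j, j != i -> j != ordS i -> 0 < orient (p i) (p (ordS i)) (p j))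
  \/ (forall j, j != i -> j != ordS i -> orient (p i) (p (ordS i)) (p j) < 0).

Definition diag_vec p (i : 'I_n) : 'rV[R]_2 := p (ordS i) - p (ord_pred i).

Definition vertex_area p (i : 'I_n) : R :=
  triangle_area (p (ord_pred i)) (p i) (p (ordS i)).

Definition d_vec p : 'rV[R]_2 := \sum_(i < n) (vertex_area p i)^-1 *: diag_vec p i.

End AffinePolygons.

(* In P(R^3), points are the 1-dimensional subspaces of R^3 and lines the     *)
(* 2-dimensional ones; the line through two distinct points is their sum,     *)
(* and the common point of two distinct lines is their intersection.          *)
Section ProjectivePolygons.
Variables (R : realType) (n : nat).
Implicit Types (p : 'I_n -> 'rV[R]_2) (P : 'I_n -> {vspace 'rV[R]_3}).

Definition affine_point (a : 'rV[R]_2) : {vspace 'rV[R]_3} :=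
  <[(row_mx a 1 : 'rV[R]_3)]>%VS.

Definition side P (i : 'I_n) : {vspace 'rV[R]_3} := (P i + P (ordS i))%VS.

Definition inv_pentagram P : 'I_n -> {vspace 'rV[R]_3} :=
  fun i => (side P (ord_pred i) :&: side P (ordS i))%VS.

Definition convex_in_affine_plane P : Prop :=
  exists p, (forall i, P i = affine_point (p i)) /\ convex_polygon p.

End ProjectivePolygons.

Section Glick.
Variables (R : realType) (n : nat).
Implicit Types (u w x : 'rV[R]_3).

(* The coefficient of u /\ w /\ x in the standard basis of Lambda^3 R^3.      *)
Definition det3 u w x : R := \det (\matrix_(i < 3) nth 0 [:: u; w; x] i).

Definition glick (v : 'I_n -> 'rV[R]_3) u : 'rV[R]_3 :=
  n%:R *: u - \sum_(i < n)
    (det3 (v (ord_pred i)) u (v (ordS i)) /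
     det3 (v (ord_pred i)) (v i) (v (ordS i))) *: v i.

Lemma det3_linear_mid u x : scalar (fun w => det3 u w x).
Proof.
move=> c w1 w2; rewrite /det3.
rewrite (determinant_multilinear (i0 := 1) (b := c) (c := 1)
  (B := \matrix_(i < 3) nth 0 [:: u; w1; x] i)
  (C := \matrix_(i < 3) nth 0 [:: u; w2; x] i)) ?mul1r //.
- by apply/rowP=> j; rewrite !mxE /= mul1r.
- by apply/matrixP=> i j; rewrite !mxE; case: i => [[|[|[|]]]].
- by apply/matrixP=> i j; rewrite !mxE; case: i => [[|[|[|]]]].
Qed.

Lemma glick_is_linear v : linear (glick v).
Proof.
move=> c u w; rewrite /glick scalerBr scalerDr !scalerA mulrC.
rewrite addrACA -opprD scaler_sumr -big_split /=; congr (_ - _).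
by apply: eq_bigr => i _; rewrite det3_linear_mid mulrDl scalerDl scalerA mulrA.
Qed.

HB.instance Definition _ v :=
  GRing.isLinear.Build R 'rV[R]_3 'rV[R]_3 *:%R (glick v) (glick_is_linear v).

Definition zcoord u : R := u 0 ord_max.

Definition affine_operator (f : {linear 'rV[R]_3 -> 'rV[R]_3}) : Prop :=
  exists2 c : R, c != 0 & forall u, zcoord (f u) = c * zcoord u.

End Glick.

(* Main.v *)
(** Work with homogeneous vectors X_i such that det(X_i, X_(i+1), X_j) > 0 for
    j <> i, i+1, and with a linear form phi vanishing on the line at infinity.
    The form g(u) = sum_i det(X_(i-1),u,X_(i+1)) / det(X_(i-1),X_i,X_(i+1))
    phi(X_i) is n phi - phi o G_P, and its restriction to ker phi is the pairing
    with d_P; so (2) and (3) both say that g is a multiple of phi. Up to one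
    shift of the index, g does not change termwise when P is replaced by S(P),
    and S(P) always has positive determinants; hence S(P) is convex in the
    affine plane iff phi > 0 on its vertices.

    If phi <= 0 at the vertex where the sides X_0X_1 and X_2X_3 meet, then the
    heights over the line X_0X_1 decrease from X_2 on, and this makes
    g(X_1 - X_0) < 0: so g is not a multiple of phi. Thus (2) implies (1).

    Conversely f = phi - g is positive on the vertices of all iterates. If f is
    not a multiple of phi and all iterates are convex, consider the minimum m
    and the maximum M of f/phi over the vertices. Each application of S
    does not decrease M and decreases m by an amount bounded below: a neighbour of the
    minimal vertex is higher by a definite amount because f is bounded below by
    a single term of its defining sum, and the two sides at that vertex are
    prolonged in a ratio that f also controls. So m becomes negative, which is
    absurd. *)

Require Import Defs.
From mathcomp Require Import all_boot all_order all_algebra.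
From mathcomp Require Import reals.
From mathcomp Require Import zify ring lra.

Set Implicit Arguments.
Unset Strict Implicit.
Unset Printing Implicit Defensive.

Import Order.TTheory GRing.Theory Num.Theory.
Local Open Scope ring_scope.

(** * Determinants in dimension 3 *)

Section Det3.
Variable R : realType.
Implicit Types (a b c d e u w : 'rV[R]_3).

Lemma det3E a b c : det3 a b c =
  a 0 0 * (b 0 1 * c 0 ord_max - b 0 ord_max * c 0 1)
  - a 0 1 * (b 0 0 * c 0 ord_max - b 0 ord_max * c 0 0)
  + a 0 ord_max * (b 0 0 * c 0 1 - b 0 1 * c 0 0).
Proof.
rewrite /det3 (expand_det_row _ 0) !big_ord_recl big_ord0 /cofactor.
rewrite !(expand_det_row _ 0) !big_ord_recl !big_ord0 /cofactor !det_mx11.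
rewrite !mxE /=.
have -> : lift (lift ord0 ord0 : 'I_2) 0 = ord0 by apply/val_inj.
have -> : lift ord0 ord0 = 1 :> 'I_3 by apply/val_inj.
have -> : lift ord0 (lift ord0 ord0) = ord_max :> 'I_3 by apply/val_inj.
have -> : lift (1 : 'I_3) ord0 = 0 by apply/val_inj.
have -> : lift (ord_max : 'I_3) ord0 = 0 by apply/val_inj.
have -> : lift (ord_max : 'I_3) (lift ord0 ord0) = 1 by apply/val_inj.
have -> : lift (1 : 'I_3) (lift ord0 ord0) = ord_max by apply/val_inj.
rewrite /= /bump /= ?(add0n,addn0,add1n) !expr0 !expr1 !expr2.
ring.
Qed.

Definition cross a b : 'rV[R]_3 := \row_j nth 0
  [:: a 0 1 * b 0 ord_max - a 0 ord_max * b 0 1;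
      a 0 ord_max * b 0 0 - a 0 0 * b 0 ord_max;
      a 0 0 * b 0 1 - a 0 1 * b 0 0] j.

Lemma row3_eq a b :
  a 0 0 = b 0 0 -> a 0 1 = b 0 1 -> a 0 ord_max = b 0 ord_max -> a = b.
Proof.
move=> h0 h1 h2; apply/rowP => -[[|[|[|//]]] hj].
- by rewrite (_ : Ordinal hj = 0) //; apply/val_inj.
- by rewrite (_ : Ordinal hj = 1) //; apply/val_inj.
- by rewrite (_ : Ordinal hj = ord_max) //; apply/val_inj.
Qed.

Ltac coords := rewrite ?det3E /cross ?mxE /=; ring.
Ltac vcoords := apply: row3_eq; coords.

Lemma det3_rot a b c : det3 a b c = det3 b c a. Proof. coords. Qed.
Lemma det3_swap a b c : det3 a c b = - det3 a b c. Proof. coords. Qed.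
Lemma det3_swapl a b c : det3 b a c = - det3 a b c. Proof. coords. Qed.
Lemma det3_aab a b : det3 a a b = 0. Proof. coords. Qed.
Lemma det3_abb a b : det3 a b b = 0. Proof. coords. Qed.
Lemma det3_aba a b : det3 a b a = 0. Proof. coords. Qed.
Lemma det3Zl k a b c : det3 (k *: a) b c = k * det3 a b c. Proof. coords. Qed.
Lemma det3Zm k a b c : det3 a (k *: b) c = k * det3 a b c. Proof. coords. Qed.
Lemma det3Zr k a b c : det3 a b (k *: c) = k * det3 a b c. Proof. coords. Qed.
Lemma det3Bl a b c d : det3 (a - b) c d = det3 a c d - det3 b c d.
Proof. coords. Qed.
Lemma det3Bm a b c d : det3 a (b - c) d = det3 a b d - det3 a c d.
Proof. coords. Qed.

Lemma crossZ k l a b : cross (k *: a) (l *: b) = (k * l) *: cross a b.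
Proof. vcoords. Qed.

(** Cramer's rule for four vectors of R^3, arranged so that either side represents the common point
    of the lines ab and cd. *)
Lemma det3_relation a b c d :
  det3 b c d *: a - det3 a c d *: b = det3 a b c *: d - det3 a b d *: c.
Proof. vcoords. Qed.

(** The three-term Plücker relation in the quotient of R^3 by [a]. *)
Lemma det3_plucker a b c d e :
  det3 a b c * det3 a d e - det3 a b d * det3 a c e
  + det3 a b e * det3 a c d = 0.
Proof. coords. Qed.

Lemma cross_crossl a b c d :
  cross (cross a b) (cross c d) = det3 a c d *: b - det3 b c d *: a.
Proof. vcoords. Qed.

Lemma cross_crossr a b c d :
  cross (cross a b) (cross c d) = det3 a b d *: c - det3 a b c *: d.
Proof. vcoords. Qed.

Lemma det3_crossl a b c d e f :
  det3 (cross a b) (cross c d) (cross e f) =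
  det3 a c d * det3 b e f - det3 b c d * det3 a e f.
Proof. coords. Qed.

Lemma det3_crossr a b c d e f :
  det3 (cross a b) (cross c d) (cross e f) =
  det3 a b d * det3 c e f - det3 a b c * det3 d e f.
Proof. coords. Qed.

(** Both outer vectors are points of the line bc, so the line joining them is a multiple of
    [cross b c]. *)
Lemma det3_cross_mid a b c p u :
  det3 (cross a (cross b c)) u (cross (cross b c) p) =
  - (det3 a (cross b c) p * det3 b c u).
Proof. coords. Qed.

End Det3.

(** * Positive cyclic sequences and the inverse pentagram map *)

Section Periodic.
Variables (T : Type) (n : nat).
Implicit Types X : nat -> T.

Definition periodic X := forall i, X (i + n)%N = X i.

Lemma periodic_shift X k : periodic X -> periodic (fun i => X (i + k)%N).
Proof. by move=> perX i; rewrite addnAC perX. Qed.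

Lemma periodicM X k i : periodic X -> X (i + k * n)%N = X i.
Proof.
by move=> perX; elim: k => [|k IH]; rewrite ?addn0 // mulSnr addnA perX.
Qed.

Lemma periodic_mod X i : periodic X -> X (i %% n)%N = X i.
Proof. by move=> perX; rewrite {2}(divn_eq i n) addnC periodicM. Qed.

Lemma periodic_from X i j : (0 < n)%N -> periodic X ->
  exists2 k, (k < n)%N & X j = X (i + k)%N.
Proof.
(* [n.-1 * i] stands for [- i] modulo [n], without truncated subtraction. *)
move=> n0 perX; exists ((j + n.-1 * i) %% n)%N; first by rewrite ltn_mod.
rewrite addnC (@periodic_mod (fun k => X (k + i)%N)).
  by rewrite (_ : _ + i = j + i * n)%N ?periodicM //; nia.
exact: periodic_shift.
Qed.

End Periodic.

Section CyclicSequences.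
Variables (R : realType) (n : nat).
Implicit Types X : nat -> 'rV[R]_3.

Definition positive X :=
  forall i j, (i.+1 < j < i + n)%N -> 0 < det3 (X i) (X i.+1) (X j).

(* A linear form is represented by a vector through the dot product. *)
Definition side_form X i := cross (X i) (X i.+1).

(* The vertex of index i + 1 of the image polygon: starting at i avoids
   predecessors. *)
Definition pentagram X i := cross (side_form X i) (side_form X i.+2).

Lemma positive_shift X k : positive X -> positive (fun i => X (i + k)%N).
Proof. by move=> posX i j hij; apply: posX; lia. Qed.

Lemma periodic_side_form X : periodic n X -> periodic n (side_form X).
Proof. by move=> perX i; rewrite /side_form -addSn !perX. Qed.

Lemma periodic_pentagram X : periodic n X -> periodic n (pentagram X).
Proof.
by move=> perX i; rewrite /pentagram -!addSn !(periodic_side_form perX).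
Qed.

Lemma pentagramEl X i : pentagram X i =
  det3 (X i) (X i.+2) (X i.+3) *: X i.+1
  - det3 (X i.+1) (X i.+2) (X i.+3) *: X i.
Proof. exact: cross_crossl. Qed.

Lemma pentagramEr X i : pentagram X i =
  det3 (X i) (X i.+1) (X i.+3) *: X i.+2
  - det3 (X i) (X i.+1) (X i.+2) *: X i.+3.
Proof. exact: cross_crossr. Qed.

Hypothesis n5 : (5 <= n)%N.

Section Positive.
Variable X : nat -> 'rV[R]_3.
Hypotheses (perX : periodic n X) (posX : positive X).

Lemma positive3 i : 0 < det3 (X i) (X i.+1) (X i.+2).
Proof. by apply: posX; lia. Qed.

(** Induction on [k]: a Plücker relation at [X i] writes det(i, i+1, k) det(i, j, k+1) as a sum of
    two positive products. *)
Lemma totally_positive i j k :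
  (i < j < k)%N -> (k < i + n)%N -> 0 < det3 (X i) (X j) (X k).
Proof.
elim: k => [|k IH]; first by lia.
move=> /andP[ij]; rewrite ltnS leq_eqVlt => /orP[/eqP <-|jk] hk.
  by rewrite det3_rot -(perX i); apply: posX; lia.
have [->|ij'] := eqVneq j i.+1; first by apply: posX; lia.
have h1 : 0 < det3 (X i) (X i.+1) (X j) by apply: posX; lia.
have h2 : 0 < det3 (X i) (X i.+1) (X k) by apply: posX; lia.
have h3 : 0 < det3 (X i) (X i.+1) (X k.+1) by apply: posX; lia.
have h4 : 0 < det3 (X i) (X k) (X k.+1).
  by rewrite det3_rot -(perX i); apply: posX; lia.
have h5 : 0 < det3 (X i) (X j) (X k) by apply: IH; lia.
have P := det3_plucker (X i) (X i.+1) (X j) (X k) (X k.+1).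
rewrite -(pmulr_rgt0 _ h2); move: P (mulr_gt0 h1 h4) (mulr_gt0 h3 h5).
set u := _ * _; set v := _ * _; set w := _ * _; lra.
Qed.

(** Sides [i] and [i.+1] meet in a positive multiple of [X i.+1], where the form of side [j] is
    positive. *)
Lemma positive_side_form : positive (side_form X).
Proof.
move=> i j hij; rewrite /side_form det3_crossl det3_aab mul0r.
rewrite subr0 mulr_gt0 ?positive3 // det3_rot -(perX i.+1).
by apply: posX; lia.
Qed.

End Positive.

Lemma positive_pentagram X :
  periodic n X -> positive X -> positive (pentagram X).
Proof.
move=> perX posX.
have perL := periodic_side_form perX; have posL := positive_side_form perX posX.
have tpL := totally_positive perL posL.
move=> i j hij; rewrite /pentagram; set L := side_form X in perL posL tpL *.
(* For this last index the left expansion has terms of opposite signs; in the right one a term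
   vanishes, as sides [j.+2] and [i.+1] coincide. *)
have [->|jn] := eqVneq j (i + n).-1.
  rewrite det3_crossr (det3_swap (L i) (L i.+1)).
  have -> : det3 (L i.+1) (L (i + n).-1) (L (i + n).-1.+2) = 0.
    by rewrite (_ : (i + n).-1.+2 = i.+1 + n)%N ?perL ?det3_aba //; lia.
  by rewrite mulr0 sub0r mulNr opprK mulr_gt0 //; apply: tpL; lia.
rewrite det3_crossl (det3_swapl (L i.+1) (L i.+2)) mulNr opprK.
have [->|ji] := eqVneq j i.+2.
  by rewrite det3_aab mulr0 add0r mulr_gt0 //; apply: tpL; lia.
have h : 0 < det3 (L i) (L i.+1) (L i.+3) * det3 (L i.+2) (L j) (L j.+2).
  by rewrite mulr_gt0 //; apply: tpL; lia.
rewrite ltr_wpDr //; have [jin|jin] := eqVneq j.+2 (i + n)%N.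
  by rewrite jin perL det3_aba mulr0.
by rewrite mulr_ge0 // ltW //; apply: tpL; lia.
Qed.

End CyclicSequences.

(** * Invariance of the Glick form *)

Section GlickForm.
Variables (R : realType) (n : nat).
Implicit Types (X : nat -> 'rV[R]_3) (f phi : 'rV[R]_3 -> R) (u : 'rV[R]_3).

Lemma scalar_formB f (lf : scalar f) a b u w :
  f (a *: u - b *: w) = a * f u - b * f w.
Proof.
have f0 : f 0 = 0.
  by apply: (addrI (f 0)); rewrite addr0 -{1}(mul1r (f 0)) -lf scale1r addr0.
by rewrite lf -scaleNr -[_ *: w]addr0 lf f0 addr0 mulNr.
Qed.

Lemma scalar_formZ f (lf : scalar f) a u : f (a *: u) = a * f u.
Proof.
by have := scalar_formB lf a 0 u u; rewrite scale0r subr0 mul0r subr0.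
Qed.

Lemma scalar_relation f (a b c d : 'rV[R]_3) : scalar f ->
  det3 b c d * f a - det3 a c d * f b = det3 a b c * f d - det3 a b d * f c.
Proof. by move=> lf; rewrite -!(scalar_formB lf) det3_relation. Qed.

Definition glick_form phi X u :=
  \sum_(0 <= i < n) det3 (X i) u (X i.+2) / det3 (X i) (X i.+1) (X i.+2)
                    * phi (X i.+1).

Lemma glick_form_scalar phi X : scalar (glick_form phi X).
Proof.
move=> a u w; rewrite /glick_form mulr_sumr -big_split /=.
by apply: eq_bigr => i _; rewrite det3_linear_mid !mulrDl !mulrA.
Qed.

Lemma sum_shift (g : nat -> R) :
  g n = g 0%N -> \sum_(0 <= i < n) g i.+1 = \sum_(0 <= i < n) g i.
Proof.
move=> gn; apply: (addrI (g 0%N)).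
by rewrite -big_nat_recl // big_nat_recr //= gn addrC.
Qed.

(** In each term every vertex occurs with equal degree above and below the fraction bar. *)
Lemma glick_form_rescale phi X (k : nat -> R) u : scalar phi ->
  (forall i, k i != 0) -> (forall i, det3 (X i) (X i.+1) (X i.+2) != 0) ->
  glick_form phi (fun i => k i *: X i) u = glick_form phi X u.
Proof.
move=> lphi k0 D0; apply: eq_bigr => i _.
rewrite (scalar_formZ lphi) !(det3Zl, det3Zm, det3Zr).
by field; rewrite !k0 D0.
Qed.

Lemma glick_form_shift phi X u : periodic n X ->
  glick_form phi X u =
  \sum_(0 <= i < n) det3 (X i.+1) u (X i.+3) / det3 (X i.+1) (X i.+2) (X i.+3)
                    * phi (X i.+2).
Proof.
move=> perX; rewrite -[LHS]sum_shift //.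
by rewrite -[n]add0n -!addSn !perX.
Qed.

Hypothesis n5 : (5 <= n)%N.

(** Image vertices [i] and [i.+2] lie on one side of [X], so term [i] of the image reduces to
    determinants of [X] and splits as [s i - r i]. The matching term of [X] is [s i.+1 - r i], and
    [s] is summed cyclically. *)
Lemma glick_form_pentagram phi X u : scalar phi -> periodic n X ->
  positive n X -> glick_form phi (pentagram X) u = glick_form phi X u.
Proof.
move=> lphi perX posX; have D i := positive3 n5 posX i.
have tpL := totally_positive n5 (periodic_side_form perX) 
  (positive_side_form n5 perX posX).
rewrite [RHS]glick_form_shift //.
pose s i := det3 (X i.+2) (X i.+3) u * phi (X i.+1)
             / det3 (X i.+1) (X i.+2) (X i.+3).
pose r i := det3 (X i.+1) (X i.+3) (X i.+4) * det3 (X i.+2) (X i.+3) u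
            * phi (X i.+2) / (det3 (X i.+1) (X i.+2) (X i.+3)
                               * det3 (X i.+2) (X i.+3) (X i.+4)).
transitivity (\sum_(0 <= i < n) (s i - r i)).
  apply: eq_bigr => i _.
  rewrite [X in det3 X u _]/pentagram [X in det3 _ u X]/pentagram.
  rewrite [X in det3 X (pentagram _ _) _]/pentagram.
  rewrite [X in det3 _ (pentagram _ _) X]/pentagram.
  rewrite ![side_form X i.+2]/side_form !det3_cross_mid.
  set K := det3 _ _ _.
  (* Sides [i], [i.+2] and [i.+4] are distinct because [n] is at least 5. *)
  have K0 : K != 0 by rewrite gt_eqF // /K; apply: tpL; lia.
  rewrite pentagramEl (scalar_formB lphi).
  have -> : det3 (X i.+2) (X i.+3)
     (det3 (X i.+1) (X i.+3) (X i.+4) *: X i.+2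
      - det3 (X i.+2) (X i.+3) (X i.+4) *: X i.+1)
     = - (det3 (X i.+2) (X i.+3) (X i.+4) * det3 (X i.+1) (X i.+2) (X i.+3)).
    by rewrite det3_rot (det3_rot (X i.+3)) det3Bl !det3Zl det3_aab mulr0 sub0r.
  rewrite /s /r; move: (D i.+1) (D i.+2).
  move: (det3 (X i.+1) (X i.+2) (X i.+3)) (det3 (X i.+2) (X i.+3) (X i.+4)).
  by move=> A B A0 B0; field; rewrite ?K0 ?gt_eqF.
rewrite sumrB -(sum_shift (g := s)); last first.
  by rewrite /s -[n]add0n -!addSn !perX.
rewrite -sumrB; apply: eq_bigr => i _.
have rel : det3 (X i.+1) u (X i.+3) * det3 (X i.+2) (X i.+3) (X i.+4) =
  det3 (X i.+3) (X i.+4) u * det3 (X i.+1) (X i.+2) (X i.+3) - 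
  det3 (X i.+1) (X i.+3) (X i.+4) * det3 (X i.+2) (X i.+3) u.
  have := det3_plucker (X i.+3) (X i.+1) (X i.+2) (X i.+4) u.
  rewrite !(det3_rot (X i.+3) (X i.+1) (X i.+2), det3_rot (X i.+3) (X i.+1) u).
  by rewrite !(det3_swapl _ (X i.+3)); lra.
rewrite /s /r; move: rel (D i.+1) (D i.+2).
move: (det3 (X i.+1) (X i.+2) (X i.+3)) (det3 (X i.+2) (X i.+3) (X i.+4)).
move=> A B rel A0 B0.
rewrite -[det3 (X i.+1) u _](mulfK (lt0r_neq0 B0)) rel.
by field; rewrite !gt_eqF.
Qed.

End GlickForm.

(** * Balanced polygons have convex images *)

Section ConvexSequences.
Variables (R : realType) (n : nat) (phi : 'rV[R]_3 -> R).
Hypotheses (n5 : (5 <= n)%N) (lphi : scalar phi).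
Implicit Types (X : nat -> 'rV[R]_3) (u : 'rV[R]_3).

Definition convex_seq X :=
  [/\ periodic n X, positive n X & forall i, 0 < phi (X i)].

Definition balanced X := exists c, forall u, glick_form n phi X u = c * phi u.

Lemma convex_seq_shift X k : convex_seq X -> convex_seq (fun i => X (i + k)%N).
Proof.
case=> perX posX phiX; split=> //.
  exact: periodic_shift.
exact: positive_shift.
Qed.

Lemma glick_form_shiftn X k u : periodic n X ->
  glick_form n phi (fun i => X (i + k)%N) u = glick_form n phi X u.
Proof.
move=> perX; elim: k => [|k <-].
  by apply: eq_bigr => i _; rewrite !addn0.
rewrite [RHS]glick_form_shift; last exact: periodic_shift.
by apply: eq_bigr => i _; rewrite !addnS.
Qed.

Lemma balanced_pentagram X :
  convex_seq X -> balanced X -> balanced (pentagram X).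
Proof.
by case=> perX posX _ [c hc]; exists c => u; rewrite glick_form_pentagram.
Qed.

(** At [X j] the summand of vertex [j] is [phi (X j)] and cancels; the others are nonpositive, and
    only that of vertex 1 is kept. *)
Lemma glick_form_vertex0 X j : convex_seq X -> (2 < j < n)%N ->
  det3 (X 0%N) (X 2%N) (X j) / det3 (X 0%N) (X 1%N) (X 2%N) * phi (X 1%N)
  <= phi (X j) - glick_form n phi X (X j).
Proof.
case=> perX posX phiX hj; have tp := totally_positive n5 perX posX.
have D i := positive3 n5 posX i.
rewrite lerBrDr /glick_form big_ltn; last by lia.
rewrite (bigD1_seq j.-1) ?mem_index_iota ?iota_uniq //=; last by lia.
rewrite (det3_swap (X 0%N) (X 2%N) (X j)) !mulNr addrA subrr add0r.
have -> : j.-1.+1 = j by lia.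
rewrite divff ?mul1r; last by rewrite lt0r_neq0 //; apply: tp; lia.
rewrite gerDl big_seq_cond sumr_le0 // => i.
rewrite mem_index_iota => /andP[hi hij].
rewrite pmulr_lle0 // pmulr_lle0 ?invr_gt0 //.
have [->|ij] := eqVneq i j; first by rewrite det3_aab.
have [<-|ij2] := eqVneq i.+2 j; first by rewrite det3_abb.
have [lij|lji] := ltnP i j.
  by rewrite det3_swap oppr_le0 ltW // tp //; lia.
by rewrite det3_swapl oppr_le0 ltW // tp //; lia.
Qed.

Lemma glick_form_vertex X i j : convex_seq X -> (i.+2 < j < i + n)%N ->
  det3 (X i) (X i.+2) (X j) / det3 (X i) (X i.+1) (X i.+2) * phi (X i.+1)
  <= phi (X j) - glick_form n phi X (X j).
Proof.
move=> cX hj; have := glick_form_vertex0 (j := j - i) (convex_seq_shift i cX).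
rewrite glick_form_shiftn ?subnK //; try lia.
  by rewrite add0n add1n add2n; apply; lia.
by case: cX.
Qed.

Lemma glick_form_vertex_lt X j : convex_seq X ->
  0 < phi (X j) - glick_form n phi X (X j).
Proof.
move=> cX; have [perX posX phiX] := cX.
(* This keeps the summand of vertex [j - 2], which is nonzero. *)
have := glick_form_vertex (i := j + n - 3) (j := j + n) cX.
rewrite perX; have h : ((j + n - 3).+2 < j + n < j + n - 3 + n)%N by lia.
move=> /(_ h); apply: lt_le_trans; rewrite mulr_gt0 // divr_gt0 //.
  by rewrite -(perX j); apply: (totally_positive n5 perX posX); lia.
exact: (positive3 n5 posX).
Qed.

Section Normalized.
Variable X : nat -> 'rV[R]_3.
Hypotheses (cX : convex_seq X) (phiX : forall i, phi (X i) = 1).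

Let perX : periodic n X. Proof. by case: cX. Qed.
Let posX : positive n X. Proof. by case: cX. Qed.
Let D i : 0 < det3 (X i) (X i.+1) (X i.+2).
Proof. exact: (positive3 n5 posX). Qed.

(** When [phi] is 1 on the vertices, determinants measure areas; the two triangulations of a
    quadrilateral have equal area. *)
Lemma area_relation i j k l :
  det3 (X j) (X k) (X l) - det3 (X i) (X k) (X l) =
  det3 (X i) (X j) (X k) - det3 (X i) (X j) (X l).
Proof.
by have := scalar_relation (X i) (X j) (X k) (X l) lphi; rewrite !phiX !mulr1.
Qed.

Let h k := det3 (X 0%N) (X 1%N) (X k).

(** [h k] is proportional to the height of [X k] over the line [X 0], [X 1]. The last term makes the
    heights bend downwards, so once they stop growing they decrease. *)
Lemma height_step k :
  (h k.+2 - h k.+1) * det3 (X 0%N) (X k) (X k.+1) =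
  (h k.+1 - h k) * det3 (X 0%N) (X k.+1) (X k.+2)
  - h k.+1 * det3 (X k) (X k.+1) (X k.+2).
Proof.
have P := det3_plucker (X 0%N) (X 1%N) (X k) (X k.+1) (X k.+2).
have := congr1 ( *%R (h k.+1)) (area_relation 0 k k.+1 k.+2).
rewrite /h; lra.
Qed.

Lemma height_decreasing k : h 3 <= h 2 -> (3 <= k < n)%N -> h k.+1 < h k.
Proof.
move=> h32; elim: k => [//|k IH] /andP[k3 kn].
have hk : h k.+1 <= h k.
  have [->|k2] := eqVneq k 2%N; first by [].
  by apply/ltW/IH; lia.
have D1 : 0 < det3 (X 0%N) (X k) (X k.+1).
  by apply: (totally_positive n5 perX posX); lia.
have D2 : 0 <= det3 (X 0%N) (X k.+1) (X k.+2).
  have [->|kn'] := eqVneq k.+2 n; first by rewrite -[n]add0n perX det3_aba.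
  by apply/ltW; apply: (totally_positive n5 perX posX); lia.
have D3 : 0 < h k.+1 by apply: posX; lia.
rewrite -subr_lt0 -(pmulr_llt0 _ D1) height_step subr_lt0.
by apply: le_lt_trans (mulr_gt0 D3 (D k)); rewrite mulr_le0_ge0 // subr_le0.
Qed.

Lemma phi_pentagram i : phi (pentagram X i) =
  det3 (X i) (X i.+2) (X i.+3) - det3 (X i.+1) (X i.+2) (X i.+3).
Proof. by rewrite pentagramEl (scalar_formB lphi) !phiX !mulr1. Qed.

Lemma phi_pentagram_heights i : phi (pentagram X i) =
  det3 (X i) (X i.+1) (X i.+3) - det3 (X i) (X i.+1) (X i.+2).
Proof. by rewrite pentagramEr (scalar_formB lphi) !phiX !mulr1. Qed.

(** The heights over side 0 still fall between [X n.-2] and [X n.-1], so the side joining these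
    meets side 0 where [phi] is positive. One such vertex fixes the sign common to a convex
    image. *)
Lemma phi_pentagram_pos_other :
  phi (pentagram X 0) <= 0 -> 0 < phi (pentagram X n.-2).
Proof.
rewrite phi_pentagram_heights subr_le0 => h32.
rewrite phi_pentagram subr_gt0.
have := height_decreasing h32 (k := n.-2); rewrite /h.
have -> : n.-2.+1 = n.-1 by lia.
have -> : n.-1.+1 = (0 + n)%N by lia.
rewrite -[(0 + n).+1]addSn !perX !(det3_rot (X 0%N)) !(det3_rot (X 1%N)).
by apply; lia.
Qed.

(** The edge vector is at infinity, so a balanced form vanishes on it. *)
Lemma glick_form_edge :
  glick_form n phi X (X 1%N - X 0%N) =
  \sum_(0 <= i < n) (h i.+2 - h i) / det3 (X i) (X i.+1) (X i.+2).
Proof.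
apply: eq_bigr => i _; rewrite phiX mulr1 det3Bm; congr (_ / _).
have := area_relation 0 1 i i.+2.
rewrite (det3_swapl (X 1%N) (X i)) (det3_swapl (X 0%N) (X i)) /h; lra.
Qed.

(* Otherwise, in the sum of glick_form_edge, the terms 0 and n-1 cancel, the
   terms 1 and 2 add up to a nonpositive multiple of h 3 - h 2, and the others
   are negative by height_decreasing. *)
Lemma balanced_phi_pentagram0 : balanced X -> 0 < phi (pentagram X 0).
Proof.
case=> c bal; rewrite ltNge phi_pentagram_heights subr_le0; apply/negP => h32.
have := glick_form_edge; rewrite bal.
rewrite -[X 1%N]scale1r -[X 0%N]scale1r (scalar_formB lphi) !phiX subrr mulr0.
have dec k : (3 <= k < n)%N -> h k.+1 < h k by exact: height_decreasing.
do 3 (rewrite big_ltn; last by lia).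
rewrite -{1}(ltn_predK n5) big_nat_recr /=; last by lia.
rewrite big_ltn; last by lia.
set S := (X in _ + X + _).
have S_le0 : S <= 0.
  rewrite /S big_seq_cond sumr_le0 // => i.
  rewrite mem_index_iota => /andP[hi _].
  rewrite pmulr_lle0 ?invr_gt0 // subr_le0 ltW //.
  by apply: lt_trans (dec i _) => //; [apply: dec; lia | lia].
have last_term :
    (h n.-1.+2 - h n.-1) / det3 (X n.-1) (X n.-1.+1) (X n.-1.+2) = -1.
  have -> : n.-1.+1 = (0 + n)%N by lia.
  rewrite -addSn /h !perX det3_abb sub0r -det3_rot mulNr divff //.
  by rewrite lt0r_neq0 // det3_rot; apply: posX; lia.
(* As [n] is at least 5, term 3 is not the last one; it makes the total strictly negative. *)
have term3 : (h 5 - h 3) / det3 (X 3) (X 4) (X 5) < 0.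
  rewrite pmulr_llt0 ?invr_gt0 // subr_lt0.
  by apply: lt_trans (dec 3%N _) => //; [apply: dec; lia | lia].
have first_terms : (h 2 - h 0) / det3 (X 0%N) (X 1%N) (X 2) = 1.
  by rewrite /h det3_aba subr0 divff // lt0r_neq0.
have middle : (h 3 - h 1) / det3 (X 1%N) (X 2) (X 3)
              + (h 4 - h 2) / det3 (X 2) (X 3) (X 4) <= 0.
  (* The numerator is h 3 - h 2 times det(X 1, X 2, X 3) + det(X 1, X 3, X 4). *)
  rewrite addf_div ?lt0r_neq0 // pmulr_lle0 ?invr_gt0 ?mulr_gt0 //.
  have P := det3_plucker (X 1%N) (X 0%N) (X 2) (X 3) (X 4).
  have := congr1 ( *%R (h 3)) (area_relation 1 2 3 4).
  have pos : 0 < det3 (X 1%N) (X 3) (X 4).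
    by apply: (totally_positive n5 perX posX); lia.
  have : (h 3 - h 2)
         * (det3 (X 1%N) (X 2) (X 3) + det3 (X 1%N) (X 3) (X 4)) <= 0.
    by rewrite mulr_le0_ge0 ?subr_le0 // addr_ge0 // ltW.
  move: P; rewrite !(det3_swapl (X 0%N)) /h det3_abb; lra.
rewrite last_term first_terms; lra.
Qed.

End Normalized.
End ConvexSequences.

(** * Reduction to vertices with [phi] equal to 1 *)

Section Normalization.
Variables (R : realType) (n : nat) (phi : 'rV[R]_3 -> R).
Hypotheses (n5 : (5 <= n)%N) (lphi : scalar phi).
Implicit Types (X : nat -> 'rV[R]_3) (u : 'rV[R]_3).

Definition normalize X i := (phi (X i))^-1 *: X i.

Lemma normalize_phi X i : 0 < phi (X i) -> phi (normalize X i) = 1.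
Proof. by move=> phiX; rewrite (scalar_formZ lphi) mulVf ?lt0r_neq0. Qed.

Lemma convex_seq_normalize X :
  convex_seq n phi X -> convex_seq n phi (normalize X).
Proof.
case=> perX posX phiX; split=> [i|i j hij|i].
- by rewrite /normalize perX.
- by rewrite det3Zl det3Zm det3Zr !mulr_gt0 ?invr_gt0 //; apply: posX.
- by rewrite normalize_phi.
Qed.

Lemma glick_form_normalize X u : convex_seq n phi X ->
  glick_form n phi (normalize X) u = glick_form n phi X u.
Proof.
case=> perX posX phiX; apply: glick_form_rescale => // i.
  by rewrite invr_neq0 // lt0r_neq0.
by rewrite lt0r_neq0 // (positive3 n5 posX).
Qed.

Lemma pentagram_normalize X i : convex_seq n phi X ->
  exists2 k, 0 < k & pentagram (normalize X) i = k *: pentagram X i.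
Proof.
case=> perX posX phiX.
rewrite /pentagram /side_form /normalize !crossZ.
by eexists; last reflexivity; rewrite !mulr_gt0 ?invr_gt0.
Qed.

Lemma phi_pentagram_normalize X i : convex_seq n phi X ->
  (0 < phi (pentagram (normalize X) i)) = (0 < phi (pentagram X i)).
Proof.
move=> cX; have [k k0 ->] := pentagram_normalize i cX.
by rewrite (scalar_formZ lphi) pmulr_rgt0.
Qed.

Lemma balanced_phi_pentagram X i : convex_seq n phi X -> balanced n phi X ->
  0 < phi (pentagram X i).
Proof.
move=> cX [c bal]; pose Y := fun j => X (j + i)%N.
have cY : convex_seq n phi Y by exact: convex_seq_shift.
rewrite -[_ X i]/(pentagram Y 0) -phi_pentagram_normalize //.
apply: (balanced_phi_pentagram0 n5) => //; first exact: convex_seq_normalize.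
  by move=> j; rewrite normalize_phi //; case: cY.
exists c => u; rewrite glick_form_normalize // glick_form_shiftn //.
by case: cX.
Qed.

Lemma exists_phi_pentagram_gt0 X : convex_seq n phi X ->
  exists i, 0 < phi (pentagram X i).
Proof.
move=> cX; case: (ltP 0 (phi (pentagram (normalize X) 0))) => h.
  by exists 0%N; rewrite -phi_pentagram_normalize.
exists n.-2; rewrite -phi_pentagram_normalize //.
apply: (phi_pentagram_pos_other n5) => //; first exact: convex_seq_normalize.
by move=> j; rewrite normalize_phi //; case: cX.
Qed.

Lemma convex_seq_pentagram X : convex_seq n phi X -> balanced n phi X ->
  convex_seq n phi (pentagram X).
Proof.
move=> cX bal; have [perX posX _] := cX; split.
- exact: periodic_pentagram.
- exact: positive_pentagram.
- by move=> i; apply: balanced_phi_pentagram.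
Qed.

End Normalization.

(** * Iterates of unbalanced polygons *)

Section Growth.
Variables (R : realType) (n : nat) (phi : 'rV[R]_3 -> R).
Hypotheses (n5 : (5 <= n)%N) (lphi : scalar phi).
Implicit Types (X : nat -> 'rV[R]_3) (u : 'rV[R]_3).

Lemma periodic_min (r : nat -> R) :
  periodic n r -> exists j, forall i, r j <= r i.
Proof.
move=> perr; have n0 : (0 < n)%N by lia.
case: (@arg_minP _ _ _ (Ordinal n0) predT (fun i : 'I_n => r i)) => // j _ hj.
by exists j => i; rewrite -(periodic_mod i perr) (hj (Ordinal (ltn_pmod i n0))).
Qed.

(** After division by [z]: [y * A / z] is at least [y / (ms + y)], which grows with [y] and
    decreases with [ms], hence is at least [d / (m + d)]. *)
Lemma min_drop (m ms d y A z : R) : 0 <= ms <= m -> 0 < d <= y -> 0 < A ->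
  0 < z -> z <= (ms + y) * A -> ms * z - y * A <= (m - d / (m + d)) * z.
Proof.
move=> /andP[ms0 msm] /andP[d0 dy] A0 z0 hz.
have md : 0 < m + d by lra.
set c := d / (m + d).
have c0 : 0 < c by rewrite divr_gt0.
have cE : c * (m + d) = d by rewrite mulfVK // lt0r_neq0.
have c1 : c <= 1 by rewrite /c ler_pdivrMr //; lra.
clearbody c.
have h1 : c * z <= c * ((ms + y) * A) by rewrite ler_pM2l.
have h2 : c * ms <= c * m by rewrite ler_pM2l.
have h3 : d * (1 - c) <= y * (1 - c) by rewrite ler_wpM2r //; lra.
have h4 : c * (ms + y) * A <= y * A by rewrite ler_pM2r //; lra.
have h5 : ms * z <= m * z by rewrite ler_pM2r.
lra.
Qed.

Section Step.
Variable X : nat -> 'rV[R]_3.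
Hypotheses (cX : convex_seq n phi X) (phiX : forall i, phi (X i) = 1).
Hypothesis phiTX : forall i, 0 < phi (pentagram X i).

Let perX : periodic n X. Proof. by case: cX. Qed.
Let posX : positive n X. Proof. by case: cX. Qed.
Let D i : 0 < det3 (X i) (X i.+1) (X i.+2).
Proof. exact: (positive3 n5 posX). Qed.

Definition defect u := phi u - glick_form n phi X u.

Lemma defect_scalar : scalar defect.
Proof.
by move=> a u w; rewrite /defect lphi glick_form_scalar; ring.
Qed.

Lemma det3_le_defect i j : (i.+2 < j < i + n)%N ->
  det3 (X i) (X i.+2) (X j) <= defect (X j) * det3 (X i) (X i.+1) (X i.+2).
Proof.
move=> hj; have := glick_form_vertex n5 cX hj.
by rewrite phiX mulr1 ler_pdivrMr.
Qed.

(** The new vertex prolongs the side from [X i] past [X i.+1], so a higher value at [X i] lowers it.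
    [defect_pentagramr] prolongs from [X i.+3] past [X i.+2]. *)
Lemma defect_pentagraml m i : defect (X i.+1) = m ->
  defect (pentagram X i) = m * phi (pentagram X i)
    - (defect (X i) - m) * det3 (X i.+1) (X i.+2) (X i.+3).
Proof.
move=> <-; rewrite pentagramEl.
by rewrite (scalar_formB defect_scalar) (scalar_formB lphi) !phiX; ring.
Qed.

Lemma defect_pentagramr m i : defect (X i.+2) = m ->
  defect (pentagram X i) = m * phi (pentagram X i)
    - (defect (X i.+3) - m) * det3 (X i) (X i.+1) (X i.+2).
Proof.
move=> <-; rewrite pentagramEr.
by rewrite (scalar_formB defect_scalar) (scalar_formB lphi) !phiX; ring.
Qed.

(** The subtracted area is dropped and the other bounded by one term of [defect]; this controls the
    ratio of prolongation. *)
Lemma phi_pentagram_lel i :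
  phi (pentagram X i) <= defect (X i) * det3 (X i.+1) (X i.+2) (X i.+3).
Proof.
rewrite (phi_pentagram_heights lphi phiX).
have := @det3_le_defect i.+1 (i + n) _; rewrite perX -(det3_rot (X i)) => h.
by have := D i; have := h ltac:(lia); lra.
Qed.

Lemma phi_pentagram_ler i :
  phi (pentagram X i) <= defect (X i.+3) * det3 (X i) (X i.+1) (X i.+2).
Proof.
rewrite (phi_pentagram lphi phiX).
have := @det3_le_defect i i.+3 _ => h.
by have := D i.+1; have := h ltac:(lia); lra.
Qed.

(** A side prolonged past the vertex of maximal [defect] does not lose height. *)
Lemma max_pentagram M : (exists j, M <= defect (X j)) ->
  exists j, M * phi (pentagram X j) <= defect (pentagram X j).
Proof.
case=> j0 hj0; have [|j hj] := @periodic_min (fun i => - defect (X i)).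
  by move=> i /=; rewrite perX.
exists (j + n).-1; rewrite (@defect_pentagraml (defect (X j))); last first.
  by rewrite (_ : (j + n).-1.+1 = j + n)%N ?perX //; lia.
have h1 : M <= defect (X j) by have := hj j0; lra.
have := hj (j + n).-1; rewrite lerN2 => h2.
rewrite -[leLHS]subr0 lerB // ?ler_wpM2r //; first exact/ltW.
by rewrite mulr_le0_ge0 ?subr_le0 // ltW.
Qed.

(* If both neighbours of the minimal vertex o were low, the ratio det(a,b,x) /
   det(a,o,b) would be large for x high, where a, b are the neighbours; but
   defect x bounds this ratio. *)
Lemma min_neighbour m W i j : 0 <= m -> 0 < W ->
  defect (X i.+1) <= m -> (forall k, defect (X i.+1) <= defect (X k)) ->
  defect (X i.+1) + W <= defect (X j) ->
  let d := W / (m + 1 + W) in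
  d <= defect (X i) - defect (X i.+1) \/ d <= defect (X i.+2) - defect (X i.+1).
Proof.
move=> m0 W0 hm hmin hj d.
have mW : 0 < m + 1 + W by lra.
have d1 : d < 1 by rewrite /d ltr_pdivrMr //; lra.
(* Thus [W * (1 - d) = d * (m + 1)]; two low neighbours would make the left side strictly
   smaller. *)
have dW : d * (m + 1 + W) = W by rewrite /d mulfVK // lt0r_neq0.
have d0 : 0 < d by rewrite divr_gt0.
have dlW : d <= W by rewrite -dW ler_peMr ?ltW //; lra.
clearbody d.
case: leP => [|h1]; first by left.
case: leP => [|h2]; first by right.
exfalso; have n0 : (0 < n)%N by apply: leq_trans n5.
have [k kn Xj] := periodic_from i j n0 perX.
move: hj; rewrite {}Xj.
have [->|k0] := eqVneq k 0%N; first by rewrite addn0; lra.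
have [->|k1] := eqVneq k 1%N; first by rewrite addn1; lra.
have [->|k2] := eqVneq k 2%N; first by rewrite addn2; lra.
move=> hj; set x := X (i + k)%N in hj.
have hk1 : (i.+2 < i + k < i + n)%N by clear -kn k0 k1 k2; lia.
have hk2 : (i.+2 < i + k < i.+1 + n)%N by clear -hk1; lia.
have hk3 : (i.+1 < i + k < i + n)%N by clear -hk1; lia.
have A1 : 0 < det3 (X i.+1) (X i.+2) x by apply: posX.
have A2 : 0 < det3 (X i) (X i.+1) x by apply: posX.
have rel := scalar_relation (X i) (X i.+1) (X i.+2) x defect_scalar.
have area := area_relation lphi phiX i i.+1 i.+2 (i + k).
have le := det3_le_defect hk1.
rewrite -/x in area le; move: (D i) A1 A2 rel area le h1 h2 hj hm.
move: (det3 _ _ (X i.+2)) (det3 (X i.+1) _ _) (det3 (X i) (X i.+1) x).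
move: (det3 (X i) _ _) (defect (X i)) (defect (X i.+1)) (defect (X i.+2)).
move: (defect x) => fx s fa fo fb A p q A0 p0 q0 rel area le h1 h2 hj hm.
have sum : p * (fa - fo) + q * (fb - fo) = A * (fx - fo).
  by have := congr1 ( *%R fo) area; lra.
have e1 : p * (fa - fo) < p * d by rewrite ltr_pM2l.
have e2 : q * (fb - fo) < q * d by rewrite ltr_pM2l.
have e3 : d * s <= d * (fx * A) by rewrite ler_pM2l.
have e4 : A * (fx - fo) < A * (d * (1 + fx)).
  by have := congr1 ( *%R d) area; lra.
rewrite ltr_pM2l // in e4.
have e5 : W * (1 - d) <= (fx - fo) * (1 - d) by rewrite ler_pM2r; lra.
have e6 : d * fo <= d * m by rewrite ler_pM2l.
lra.
Qed.

(** The side from a high neighbour is prolonged past the minimal vertex [X i.+2]: to image vertex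
    [i.+1] from the left, [i] from the right. *)
Lemma min_pentagram m W : 0 <= m -> 0 < W ->
  (exists j, defect (X j) <= m) -> (exists j, m + W <= defect (X j)) ->
  let d := W / (m + 1 + W) in
  exists j, defect (pentagram X j) <= (m - d / (m + d)) * phi (pentagram X j).
Proof.
move=> m0 W0 [j1 hj1] [j2 hj2] d.
have d0 : 0 < d by rewrite divr_gt0 //; lra.
have [|j hj] := @periodic_min (fun i => defect (X i)).
  by move=> i /=; rewrite perX.
pose i := (j + n - 2)%N.
have Ei : X i.+2 = X j by rewrite (_ : i.+2 = j + n)%N ?perX // /i; lia.
have ms0 : 0 <= defect (X i.+2) by rewrite Ei; apply/ltW/glick_form_vertex_lt.
have hmin k : defect (X i.+2) <= defect (X k) by rewrite Ei.
have msm : defect (X i.+2) <= m by apply: le_trans hj1.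
have := @min_neighbour m W i.+1 j2 m0 W0 msm hmin.
rewrite -/d => nb; case: nb => [|hd|hd]; first by lra.
- exists i.+1; rewrite (defect_pentagraml (erefl _)).
  apply: min_drop => //; rewrite ?ms0 ?d0 //.
  by rewrite addrC subrK; apply: phi_pentagram_lel.
- exists i; rewrite (defect_pentagramr (erefl _)).
  apply: min_drop => //; rewrite ?ms0 ?d0 //.
  by rewrite addrC subrK; apply: phi_pentagram_ler.
Qed.

End Step.

End Growth.

Section Iteration.
Variables (R : realType) (n : nat) (phi : 'rV[R]_3 -> R).
Hypotheses (n5 : (5 <= n)%N) (lphi : scalar phi).
Implicit Types (X : nat -> 'rV[R]_3) (u : 'rV[R]_3).

Lemma defect_normalize X u : convex_seq n phi X ->
  defect n phi (normalize phi X) u = defect n phi X u.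
Proof. by move=> cX; rewrite /defect glick_form_normalize. Qed.

(** Positive rescaling preserves [defect / phi], so the estimates for normalized vertices apply with
    [W = M - m]. *)
Lemma step_pentagram X m M :
  convex_seq n phi X -> convex_seq n phi (pentagram X) ->
  0 <= m < M ->
  (exists j, defect n phi X (X j) <= m * phi (X j)) ->
  (exists j, M * phi (X j) <= defect n phi X (X j)) ->
  let d := (M - m) / (M + 1) in
  (exists j, defect n phi X (pentagram X j) <=
             (m - d / (m + d)) * phi (pentagram X j)) /\
  (exists j, M * phi (pentagram X j) <= defect n phi X (pentagram X j)).
Proof.
move=> cX cTX /andP[m0 mM] [j1 h1] [j2 h2] d; have [perX posX phiX] := cX.
pose Y := normalize phi X.
have cY : convex_seq n phi Y by exact: convex_seq_normalize.
have phiY i : phi (Y i) = 1 by rewrite /Y normalize_phi.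
have phiTY i : 0 < phi (pentagram Y i).
  by rewrite (phi_pentagram_normalize lphi _ cX) //; case: cTX.
have defY := defect_normalize _ cX.
have ldef := defect_scalar n lphi X.
have defYX i : defect n phi Y (Y i) = (phi (X i))^-1 * defect n phi X (X i).
  by rewrite defY (scalar_formZ ldef).
have back i a : (defect n phi Y (pentagram Y i) <= a * phi (pentagram Y i)) =
    (defect n phi X (pentagram X i) <= a * phi (pentagram X i)).
  have [k k0 ->] := pentagram_normalize i cX.
  by rewrite defY (scalar_formZ ldef) (scalar_formZ lphi) mulrCA ler_pM2l.
have backM i : (M * phi (pentagram Y i) <= defect n phi Y (pentagram Y i)) =
    (M * phi (pentagram X i) <= defect n phi X (pentagram X i)).
  have [k k0 ->] := pentagram_normalize i cX.
  by rewrite defY (scalar_formZ ldef) (scalar_formZ lphi) mulrCA ler_pM2l.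
have max : exists j, M <= defect n phi Y (Y j).
  by exists j2; rewrite defYX mulrC ler_pdivlMr.
split; last first.
  have [j hj] := max_pentagram n5 lphi cY phiY phiTY max.
  by exists j; rewrite -backM.
have min : exists j, defect n phi Y (Y j) <= m.
  by exists j1; rewrite defYX mulrC ler_pdivrMr.
have W0 : 0 < M - m by rewrite subr_gt0.
have := min_pentagram n5 lphi cY phiY phiTY m0 W0 min.
rewrite addrC subrK (_ : m + 1 + (M - m) = M + 1); last by ring.
move=> /(_ max).
by case=> j; rewrite back; exists j.
Qed.

(** A lower minimum gives a larger drop, so the drop computed from the initial minimum bounds all
    later ones from below. *)
Lemma drop_mono (m m' M : R) : 0 <= m' -> m' <= m -> m < M ->
  (M - m) / (M + 1) / (m + (M - m) / (M + 1)) <=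
  (M - m') / (M + 1) / (m' + (M - m') / (M + 1)).
Proof.
move=> m0 mm mM; set d := (M - m) / _; set d' := (M - m') / _.
have M1 : 0 < (M + 1)^-1 by rewrite invr_gt0; lra.
have d0 : 0 < d by rewrite mulr_gt0 // subr_gt0.
have dd : d <= d' by rewrite ler_pM2r //; lra.
clearbody d d'.
rewrite ler_pdivrMr; last by lra.
rewrite mulrAC ler_pdivlMr; last by lra.
have h1 : d * m' <= d' * m' by rewrite ler_wpM2r.
have h2 : d' * m' <= d' * m by rewrite ler_wpM2l //; lra.
lra.
Qed.

Lemma all_convex_balanced X :
  (forall k, convex_seq n phi (iter k (@pentagram R) X)) -> balanced n phi X.
Proof.
move=> cTX; have cX : convex_seq n phi X := cTX 0%N.
have [perX posX phiX] := cX.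
pose f := defect n phi X; have lf : scalar f := defect_scalar n lphi X.
(* By invariance one form [f] serves all iterates. *)
have fE k u : defect n phi (iter k (@pentagram R) X) u = f u.
  elim: k => [//|k IH]; rewrite -IH /defect /=.
  by have [p q _] := cTX k; rewrite glick_form_pentagram.
pose r i := f (X i) / phi (X i).
have fr i : f (X i) = r i * phi (X i) by rewrite divfK // lt0r_neq0.
have absurd i j : r i < r j -> False.
  set m := r i; set M := r j => mM.
  have fpos k l : 0 < f (iter k (@pentagram R) X l).
    by rewrite -(fE k); apply: glick_form_vertex_lt.
  have m0 : 0 <= m by rewrite divr_ge0 // ltW // (fpos 0%N).
  pose d := (M - m) / (M + 1); pose c := d / (m + d).
  have d0 : 0 < d by rewrite divr_gt0 ?subr_gt0 //; lra.
  have c0 : 0 < c by rewrite divr_gt0 //; lra.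
  have iterate k :
      (exists j, f (iter k (@pentagram R) X j)
                 <= (m - k%:R * c) * phi (iter k (@pentagram R) X j)) /\
      (exists j, M * phi (iter k (@pentagram R) X j)
                 <= f (iter k (@pentagram R) X j)).
    elim: k => [|k [min max]].
      by rewrite mul0r subr0; split; [exists i | exists j]; rewrite fr.
    set mk := m - k%:R * c in min.
    have mk0 : 0 <= mk.
      case: min => l hl; have [_ _ phik] := cTX k.
      by rewrite -(pmulr_lge0 _ (phik l)) (le_trans (ltW (fpos k l))).
    have mkm : mk <= m by rewrite /mk gerBl mulr_ge0 // ltW.
    have := step_pentagram (m := mk) (M := M) (cTX k) (cTX k.+1).
    rewrite mk0 (le_lt_trans mkm mM) => /(_ isT).
    case=> [||[l hl] [l' hl']].
    - by case: min => l hl; exists l; rewrite fE.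
    - by case: max => l hl; exists l; rewrite fE.
    split; last by exists l'; rewrite fE in hl'.
    exists l; rewrite fE in hl; apply: le_trans hl _.
    rewrite ler_pM2r; last by case: (cTX k.+1) => _ _; apply.
    have := drop_mono mk0 mkm mM; rewrite -/d -/c.
    have -> : k.+1%:R * c = k%:R * c + c by rewrite -natr1; ring.
    have : mk = m - k%:R * c by [].
    set drop := _ / (mk + _); clearbody drop; lra.
  have [k hk] : exists k : nat, m < k%:R * c.
    exists (Num.bound (m / c)); rewrite -ltr_pdivrMr //.
    by apply: archi_boundP; rewrite divr_ge0 // ltW.
  have [[l hl] _] := iterate k; have [_ _ phik] := cTX k.
  have := lt_le_trans (fpos k l) hl; rewrite pmulr_lgt0 //; lra.
have rE i : r i = r 0%N.
  by case: (ltgtP (r i) (r 0%N)) => // /absurd.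
(* [f] and [r 0 * phi] agree on three independent vertices. *)
have D := positive3 n5 posX 0.
exists (1 - r 0%N) => u; suff : f u = r 0%N * phi u by rewrite /f /defect; lra.
have := scalar_relation (X 0%N) (X 1%N) (X 2) u lf.
have := scalar_relation (X 0%N) (X 1%N) (X 2) u lphi.
rewrite !fr !rE => /(congr1 ( *%R (r 0%N))) e1 e2.
by apply: (mulfI (lt0r_neq0 D)); lra.
Qed.

End Iteration.

(** * Affine coordinates and projective points *)

Section Coordinates.
Variable R : realType.
Implicit Types (a b c : 'rV[R]_2) (u w : 'rV[R]_3).

Definition lift_point a : 'rV[R]_3 := row_mx a 1.

Lemma lift_point0 a : lift_point a 0 0 = a 0 0.
Proof. by rewrite -(row_mxEl a 1); congr (row_mx _ _ _ _); apply/val_inj. Qed.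

Lemma lift_point1 a : lift_point a 0 1 = a 0 1.
Proof. by rewrite -(row_mxEl a 1); congr (row_mx _ _ _ _); apply/val_inj. Qed.

Lemma zcoord_lift_point a : zcoord (lift_point a) = 1.
Proof.
transitivity (row_mx a (1 : 'rV_1) 0 (rshift 2 0)).
  by congr (row_mx _ _ _ _); apply/val_inj.
by rewrite row_mxEr mxE.
Qed.

Lemma orientE a b c : orient a b c =
  (b 0 0 - a 0 0) * (c 0 1 - a 0 1) - (b 0 1 - a 0 1) * (c 0 0 - a 0 0).
Proof.
rewrite /orient (expand_det_row _ 0) !big_ord_recl big_ord0 /cofactor.
rewrite !det_mx11 !mxE.
have -> : split (0 : 'I_(1 + 1)) = inl 0.
  by case: splitP => j // _; rewrite (ord1 j).
have -> : split (lift 0 0 : 'I_(1 + 1)) = inr 0.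
  by case: splitP => j //; [rewrite (ord1 j) | rewrite (ord1 j)].
have -> : lift (lift ord0 ord0 : 'I_2) 0 = 0 by apply/val_inj.
have -> : lift ord0 0 = 1 :> 'I_2 by apply/val_inj.
rewrite !mxE /= expr0 expr1; ring.
Qed.

Lemma det3_lift_point a b c :
  det3 (lift_point a) (lift_point b) (lift_point c) = orient a b c.
Proof.
rewrite det3E orientE !lift_point0 !lift_point1.
by rewrite -!/(zcoord _) !zcoord_lift_point; ring.
Qed.

Lemma zcoord_scalar : scalar (@zcoord R).
Proof. by move=> k u w; rewrite /zcoord !mxE. Qed.

Lemma zcoord_form_scalar (s : R) : scalar (fun u => s * zcoord u).
Proof. by move=> k u w; rewrite zcoord_scalar; ring. Qed.

Lemma lift_point_surj u : zcoord u != 0 ->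
  u = zcoord u *: lift_point (\row_j (u 0 (widen_ord (leqnSn 2) j) / zcoord u)).
Proof.
move=> z0; apply: row3_eq; rewrite [RHS]mxE.
- rewrite lift_point0 mxE mulrCA divff // mulr1.
  by congr (u 0 _); apply/val_inj.
- rewrite lift_point1 mxE mulrCA divff // mulr1.
  by congr (u 0 _); apply/val_inj.
- by rewrite -/(zcoord (lift_point _)) zcoord_lift_point mulr1.
Qed.

Lemma vline_eq u w :
  <[u]>%VS = <[w]>%VS -> w != 0 -> exists2 k, k != 0 & w = k *: u.
Proof.
move=> e w0; have /vlineP [k wE] : w \in <[u]>%VS by rewrite e memv_line.
by exists k => //; apply: contraNneq w0 => k0; rewrite wE k0 scale0r.
Qed.

Lemma vlineZ (k : R) u : k != 0 -> <[k *: u]>%VS = <[u]>%VS.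
Proof.
move=> k0; apply/eqP; rewrite eqEsubv -!memvE memvZ ?memv_line //=.
by rewrite -[X in X \in _](scalerK k0) memvZ ?memv_line.
Qed.

Lemma cap_lines (a b c d : 'rV[R]_3) : det3 b c d != 0 ->
  ((<[a]> + <[b]>) :&: (<[c]> + <[d]>))%VS =
  <[cross (cross a b) (cross c d)]>%VS.
Proof.
move=> D0; apply/vspaceP => x; apply/idP/idP; last first.
  move=> /vlineP[k ->]; rewrite memvZ // memv_cap {1}cross_crossl cross_crossr.
  by rewrite (addvC <[a]>%VS) !memv_add ?memvN ?memvZ ?memv_line.
move=> /memv_capP[/memv_addP[u1 /vlineP[k1 ->] [u2 /vlineP[k2 ->] xE]]].
move=> /memv_addP[u3 /vlineP[k3 ->] [u4 /vlineP[k4 ->] xE']].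
(* The coefficient of [a] in [cross_crossl] is [- det3 b c d]. *)
apply/vlineP; exists (- k1 / det3 b c d).
have : det3 x c d = 0.
  rewrite xE' -[k4 *: d]opprK -scaleNr det3Bl !det3Zl det3_aba det3_aab.
  by ring.
rewrite {1}xE -[k2 *: b]opprK -scaleNr det3Bl !det3Zl => e.
rewrite cross_crossl xE scalerBr !scalerA divfK // scaleNr opprK addrC.
congr (_ *: b + _); apply: (mulIf D0); rewrite mulrAC divfK //; lra.
Qed.

End Coordinates.

(** * Cyclic indices as natural numbers *)

Section Indices.
Variable n' : nat.
Local Notation n := n'.+1.
Implicit Types i j : 'I_n.

Lemma inZpS (k : nat) : inZp k.+1 = ordS (inZp k) :> 'I_n.
Proof. by apply: val_inj; rewrite /= -[in RHS]addn1 modnDml addn1. Qed.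

Lemma ord_pred_inZpS (k : nat) : ord_pred (inZp k.+1) = inZp k :> 'I_n.
Proof. by rewrite inZpS ordSK. Qed.

Lemma periodic_inZp (T : Type) (q : 'I_n -> T) :
  periodic n (fun k => q (inZp k)).
Proof. by move=> k; congr q; apply: val_inj; rewrite /= modnDr. Qed.

Lemma inZpDM (k l : nat) : inZp (k + l * n) = inZp k :> 'I_n.
Proof. by apply: val_inj; rewrite /= addnC modnMDl. Qed.

Lemma off_side_index i j : j != i -> j != ordS i ->
  exists2 k : nat, (i.+1 < k < i + n)%N & inZp k = j.
Proof.
move=> ji jSi; have ijn : i <> j :> nat.
  by move=> /val_inj e; rewrite e eqxx in ji.
have jS : (i.+1 %% n)%N <> j :> nat.
  by move=> e; case/eqP: jSi; apply: val_inj.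
have [lij|lji] := ltnP i j.
  exists (j : nat); last exact: valZpK.
  have jn := ltn_ord j; have : i.+1 <> j.
    by move=> e; apply: jS; rewrite modn_small ?e.
  by lia.
exists (j + n)%N; last by rewrite -[n in (_ + n)%N]mul1n inZpDM valZpK.
have : i.+1 <> (j + n)%N.
  by move=> e; apply: jS; rewrite e modnDr modn_small.
have := ltn_ord i; lia.
Qed.

Lemma off_side_inZp (k l : nat) : (k.+1 < l < k + n)%N ->
  inZp l != inZp k :> 'I_n /\ inZp l != ordS (inZp k) :> 'I_n.
Proof.
move=> hl; have E d : (0 < d < n)%N -> inZp (k + d) != inZp k :> 'I_n.
  move=> hd; rewrite -val_eqE /= -[X in _ != (X %% _)%N]addn0 eqn_modDl mod0n.
  by rewrite modn_small; lia.
split; first by rewrite -(subnKC (ltnW (ltnW (andP hl).1))) E //; lia.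
rewrite -inZpS -val_eqE /= -(subnKC (ltnW (andP hl).1)).
by rewrite -[X in _ != (X %% _)%N]addn0 eqn_modDl mod0n modn_small; lia.
Qed.

End Indices.

Lemma same_sign (R : realDomainType) (s a b : R) :
  0 < s * a -> 0 < a * b -> 0 < s * b.
Proof.
move=> sa ab; have saab := mulr_gt0 sa ab.
have a2 : 0 < a * a.
  rewrite -expr2 exprn_even_gt0 //=.
  by apply: contraTneq ab => ->; rewrite mul0r ltxx.
by rewrite -(pmulr_rgt0 _ a2); lra.
Qed.

(** * Orientation of convex polygons *)

Section ConvexPolygons.
Variables (R : realType) (n' : nat).
Local Notation n := n'.+1.
Hypothesis n5 : (5 <= n)%N.
Implicit Types (p : 'I_n -> 'rV[R]_2) (P : 'I_n -> {vspace 'rV[R]_3}).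
Implicit Types X : nat -> 'rV[R]_3.

Definition side_orient p (k l : nat) : R :=
  orient (p (inZp k)) (p (inZp k.+1)) (p (inZp l)).

Lemma convex_polygonE p : convex_polygon p <->
  forall k l l' : nat, (k.+1 < l < k + n)%N -> (k.+1 < l' < k + n)%N ->
    0 < side_orient p k l * side_orient p k l'.
Proof.
rewrite /side_orient; split=> [cp k l l' hl hl'|cp i].
  rewrite inZpS; have [h1 h2] := off_side_inZp hl.
  have [h1' h2'] := off_side_inZp hl'.
  by case: (cp (inZp k)) => s; [rewrite mulr_gt0 ?s | rewrite nmulr_rgt0 ?s].
have iS : inZp i.+1 = ordS i by rewrite inZpS valZpK.
pose o (k : nat) := orient (p i) (p (ordS i)) (p (inZp k)).
have cpi k k' : (i.+1 < k < i + n)%N -> (i.+1 < k' < i + n)%N -> 0 < o k * o k'.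
  by move=> hk hk'; have := cp i k k' hk hk'; rewrite iS valZpK.
have hi : (i.+1 < i.+2 < i + n)%N by lia.
have := cpi _ _ hi hi.
case: (ltrgt0P (o i.+2)) => [oi|oi|->]; last by rewrite mul0r ltxx.
- move=> _; left=> j ji jSi; have [k hk <-] := off_side_index ji jSi.
  by rewrite -(pmulr_rgt0 _ oi) cpi.
- move=> _; right=> j ji jSi; have [k hk <-] := off_side_index ji jSi.
  by rewrite -(nmulr_rgt0 _ oi) cpi.
Qed.

(** Adjacent sides have the same sign: the triangle k, k+1, k+2 tests vertex k+2 against side k and
    vertex k against side k+1. *)
Lemma convex_polygon_sign p : convex_polygon p ->
  exists2 s : R, s * s = 1 & forall k l : nat, (k.+1 < l < k + n)%N ->
    0 < s * side_orient p k l.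
Proof.
move/convex_polygonE => cp.
pose o k := side_orient p k k.+2.
have r k : (k.+1 < k.+2 < k + n)%N by lia.
have o0 : 0 < o 0%N * o 0%N := cp _ _ _ (r 0%N) (r 0%N).
have o0' : o 0%N != 0 by apply: contraTneq o0 => ->; rewrite mul0r ltxx.
exists (Num.sg (o 0%N)); first by rewrite -expr2 sqr_sg o0'.
have oP k : 0 < Num.sg (o 0%N) * o k.
  elim: k => [|k IH]; first by rewrite -normrEsg normr_gt0.
  apply: same_sign IH _.
  have oE : side_orient p k.+1 (k + n) = o k.
    rewrite /o /side_orient periodic_inZp -!det3_lift_point.
    by rewrite det3_rot det3_rot.
  by rewrite mulrC -oE; apply: cp; lia.
by move=> k l hl; apply: same_sign (oP k) _; apply: cp.
Qed.

End ConvexPolygons.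

(** * Projective polygons and the three conditions *)

Section Correspondence.
Variables (R : realType) (n' : nat).
Local Notation n := n'.+1.
Hypothesis n5 : (5 <= n)%N.
Implicit Types (p : 'I_n -> 'rV[R]_2) (P : 'I_n -> {vspace 'rV[R]_3}).
Implicit Types X : nat -> 'rV[R]_3.

Lemma iter_pentagram X m : periodic n X -> positive n X ->
  periodic n (iter m (@pentagram R) X) /\ positive n (iter m (@pentagram R) X).
Proof.
move=> perX posX; elim: m => [//|m [IH1 IH2]]; split.
  exact: periodic_pentagram.
exact: positive_pentagram.
Qed.

(** [pentagram] numbers vertex i + 1 as i, so each step shifts by -1, which is [n'] modulo [n]. *)
Lemma iter_inv_pentagram P X m k : periodic n X -> positive n X ->
  (forall k, P (inZp k) = <[X k]>%VS) ->
  iter m (@inv_pentagram R n) P (inZp k) =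
  <[iter m (@pentagram R) X (k + m * n')%N]>%VS.
Proof.
move=> perX posX hP; elim: m k => [|m IH] k; first by rewrite addn0.
have [perT posT] := iter_pentagram m perX posX.
rewrite -(inZpDM n' k 1) mul1n addnS /= /inv_pentagram.
rewrite ord_pred_inZpS -inZpS /side -!inZpS !IH.
set j := (k + n' + m * n')%N.
have -> : (k + m.+1 * n' = j)%N by rewrite /j mulSn addnA.
by rewrite !addSn; apply: cap_lines; rewrite lt0r_neq0 // (positive3 n5 posT).
Qed.

Lemma det3_lift_points p (z : nat -> R) X :
  (forall k, X k = z k *: lift_point (p (inZp k))) -> forall k l,
  det3 (X k) (X k.+1) (X l) = z k * z k.+1 * z l * side_orient p k l.
Proof.
by move=> hX k l; rewrite !hX det3Zl det3Zm det3Zr det3_lift_point !mulrA.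
Qed.

(** The determinants share the factor [z k * z k.+1], which enters their product as a square. *)
Lemma affine_sign p (z : nat -> R) X k l l' :
  (forall k, X k = z k *: lift_point (p (inZp k))) ->
  0 < det3 (X k) (X k.+1) (X l) -> 0 < det3 (X k) (X k.+1) (X l') ->
  (0 < side_orient p k l * side_orient p k l') = (0 < z l * z l').
Proof.
move=> hX; rewrite !(det3_lift_points hX) => h h'.
have := mulr_gt0 h h'.
have -> : z k * z k.+1 * z l * side_orient p k l *
  (z k * z k.+1 * z l' * side_orient p k l') =
  (z k * z k.+1) ^+ 2
  * ((z l * z l') * (side_orient p k l * side_orient p k l')).
  by ring.
have zz : 0 < (z k * z k.+1) ^+ 2.
  rewrite exprn_even_gt0 //=; apply: contraTneq h => ->.
  by rewrite !mul0r ltxx.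
rewrite pmulr_rgt0 // => pos.
by apply/idP/idP => q; move: pos; rewrite ?(pmulr_lgt0 _ q) ?(pmulr_rgt0 _ q).
Qed.

(** Products appear because all z-coordinates may be negative: this is the clockwise case. *)
Lemma convex_in_affine_planeE P X : periodic n X -> positive n X ->
  (forall k, P (inZp k) = <[X k]>%VS) ->
  convex_in_affine_plane P <-> forall k l, 0 < zcoord (X k) * zcoord (X l).
Proof.
move=> perX posX hP; split=> [[q [qP cq]] k l|zX].
  have X0 j : X j != 0.
    apply: contraTneq (positive3 n5 posX j) => ->.
    by rewrite -(scale0r 0) det3Zl mul0r ltxx.
  have Xq j : X j = zcoord (X j) *: lift_point (q (inZp j)).
    have := qP (inZp j); rewrite hP /affine_point => /esym/vline_eq/(_ (X0 j)).
    case=> c c0 ->; rewrite -/(lift_point _).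
    by rewrite (scalar_formZ (@zcoord_scalar R)) zcoord_lift_point mulr1.
  pose z j := zcoord (X j).
  (* For a fixed side, all other vertices have z of the same sign, and two
     consecutive vertices avoid some side. *)
  have step j : 0 < z j * z j.+1.
    have h1 : ((j + n - 2).+1 < j + n < j + n - 2 + n)%N by lia.
    have h2 : ((j + n - 2).+1 < j.+1 + n < j + n - 2 + n)%N by lia.
    have : 0 < side_orient q (j + n - 2) (j + n)
               * side_orient q (j + n - 2) (j.+1 + n).
      by move/convex_polygonE: cq; apply.
    by rewrite (affine_sign (z := z) Xq) ?posX // /z !perX.
  have z0 j : 0 < z 0%N * z j.
    elim: j => [|j IH].
      have := step 0%N; case: (eqVneq (z 0%N) 0) => [->|h _].
        by rewrite mul0r ltxx.
      by rewrite -expr2 exprn_even_gt0.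
    exact: same_sign IH (step j).
  by rewrite -/(z k) -/(z l); apply: same_sign (z0 l); rewrite mulrC.
have z0 j : zcoord (X j) != 0.
  by apply: contraTneq (zX j j) => ->; rewrite mul0r ltxx.
pose q (i : 'I_n) := \row_j (X i 0 (widen_ord (leqnSn 2) j) / zcoord (X i)).
have Xq j : X j = zcoord (X j) *: lift_point (q (inZp j)).
  rewrite {1}(lift_point_surj (z0 j)) /q; congr (_ *: lift_point _).
  by rewrite /= (periodic_mod j perX).
exists q; split=> [i|].
  by rewrite -[i in P i]valZpK hP Xq vlineZ // valZpK.
apply/convex_polygonE => // k l l' hl hl'.
by rewrite (affine_sign (z := fun k => zcoord (X k)) Xq) ?posX.
Qed.

Lemma zcoord_glick (v : 'I_n -> 'rV[R]_3) u :
  zcoord (glick v u) =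
  n%:R * zcoord u - glick_form n (@zcoord R) (fun k => v (inZp k)) u.
Proof.
rewrite /glick /zcoord !mxE summxE; congr (_ - _).
rewrite (reindex_inj (can_inj (@ordSK n))) /glick_form big_mkord.
apply: eq_bigr => i _; rewrite !mxE ordSK !inZpS !valZpK.
by congr (_ * _).
Qed.

(* A clockwise polygon (s = -1) is lifted to the vectors - (p, 1), so that the
   determinants are positive and phi = - zcoord is positive on the vertices. *)
Section ConvexPolygon.
Variables (p : 'I_n -> 'rV[R]_2) (s : R).
Hypotheses (s2 : s * s = 1).
Hypothesis sp : forall k l : nat,
  (k.+1 < l < k + n)%N -> 0 < s * side_orient p k l.

Let phi (u : 'rV[R]_3) := s * zcoord u.
Let L k := lift_point (p (inZp k)).
Let X k := s *: L k.

Let lphi : scalar phi. Proof. exact: zcoord_form_scalar. Qed.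

Let s0 : s != 0.
Proof. by apply: contra_eq_neq s2 => ->; rewrite mul0r eq_sym oner_eq0. Qed.

Lemma convex_seq_lift : convex_seq n phi X.
Proof.
split=> [k|k l hl|k].
- by rewrite /X /L periodic_inZp.
- rewrite (@det3_lift_points p (fun=> s)) // s2 mul1r; exact: sp.
- by rewrite (scalar_formZ lphi) /phi zcoord_lift_point mulr1 s2.
Qed.

Lemma orient_neq0 k : det3 (L k) (L k.+1) (L k.+2) != 0.
Proof.
rewrite det3_lift_point -/(side_orient p k k.+2).
have : 0 < s * side_orient p k k.+2 by apply: sp; lia.
by apply: contraTneq => ->; rewrite mulr0 ltxx.
Qed.

Let g := glick_form n (@zcoord R) L.

Lemma glick_form_lift u : glick_form n phi X u = s * g u.
Proof.
rewrite (@glick_form_rescale _ _ _ _ (fun=> s)) //; last exact: orient_neq0.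
by rewrite /g /glick_form mulr_sumr; apply: eq_bigr => i _; rewrite mulrCA.
Qed.

Lemma balanced_zcoord :
  balanced n phi X <-> exists c, forall u, g u = c * zcoord u.
Proof.
split=> -[c h]; exists c => u; last by rewrite glick_form_lift h mulrCA.
by apply: (mulfI s0); rewrite -glick_form_lift h mulrCA.
Qed.

Lemma balanced_affine (v : 'I_n -> 'rV[R]_3) :
  (forall i, <[v i]>%VS = affine_point (p i)) ->
  balanced n phi X <-> affine_operator (glick v).
Proof.
move=> hv; have zv u : zcoord (glick v u) = n%:R * zcoord u - g u.
  rewrite zcoord_glick; congr (_ - _).
  have vE i : exists2 k, k != 0 & v i = k *: lift_point (p i).
    have lift0 : lift_point (p i) != 0.
      apply/eqP => /(congr1 (@zcoord R)); rewrite zcoord_lift_point /zcoord mxE.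
      by apply/eqP; rewrite oner_eq0.
    have [k k0 e] := vline_eq (hv i) lift0.
    by exists k^-1; rewrite ?invr_neq0 // [lift_point _]e scalerK.
  have vz i : v i = zcoord (v i) *: lift_point (p i).
    have [k _ ->] := vE i.
    by rewrite (scalar_formZ (@zcoord_scalar R)) zcoord_lift_point mulr1.
  rewrite /g -(@glick_form_rescale _ _ _ L (fun k => zcoord (v (inZp k)))).
  - by apply: eq_bigr => i _; rewrite /L -!vz.
  - exact: zcoord_scalar.
  - move=> i; have [k k0 ->] := vE (inZp i).
    by rewrite (scalar_formZ (@zcoord_scalar R)) zcoord_lift_point mulr1.
  - exact: orient_neq0.
rewrite balanced_zcoord; split=> [[c h]|[c c0 h]]; last first.
  by exists (n%:R - c) => u; have := h u; rewrite zv; lra.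
exists (n%:R - c); last by move=> u; rewrite zv h; ring.
have cX := convex_seq_lift; have [_ _ phiX] := cX.
(* As [phi - g] is positive at a vertex, c < 1 <= n, so the factor n - c is nonzero. *)
have := glick_form_vertex_lt n5 0 cX.
rewrite glick_form_lift h /phi mulrCA -[X in X - _]mul1r -mulrBl.
rewrite (pmulr_lgt0 _ (phiX 0%N)) subr_gt0 => c1.
by rewrite lt0r_neq0 // subr_gt0 (lt_le_trans c1) // ler1n.
Qed.

Lemma norm_orient k : `|side_orient p k k.+2| = s * side_orient p k k.+2.
Proof.
have h : 0 < s * side_orient p k k.+2 by apply: sp; lia.
have : s == 1 \/ s == -1 by apply/orP; rewrite -eqf_sqr expr2 s2 expr1n.
by rewrite -(gtr0_norm h) normrM => -[] /eqP ->; rewrite ?normrN normr1 mul1r.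
Qed.

(** For [u] at infinity, det(X_(i-1), u, X_(i+1)) is the planar determinant of [u] and [diag_vec];
    [s / 2] turns orientations into areas. *)
Lemma glick_form_infinity u : zcoord u = 0 ->
  g u = s / 2 * (u 0 0 * d_vec p 0 1 - u 0 1 * d_vec p 0 0).
Proof.
rewrite /zcoord => uz.
have dE j : d_vec p 0 j = \sum_(0 <= i < n) (s * side_orient p i i.+2 / 2)^-1 *
    (p (inZp i.+2) 0 j - p (inZp i) 0 j).
  rewrite /d_vec summxE (reindex_inj (can_inj (@ordSK n))) big_mkord.
  apply: eq_bigr => i _; rewrite /diag_vec !mxE /vertex_area /triangle_area.
  rewrite -norm_orient /side_orient ordSK !inZpS !valZpK; congr (_ * _).
rewrite !dE !mulr_sumr -sumrB mulr_sumr; apply: eq_bigr => i _.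
rewrite {2}/L zcoord_lift_point mulr1 det3_lift_point -/(side_orient p i i.+2).
have o0 := orient_neq0 i.
rewrite det3_lift_point -/(side_orient p i i.+2) in o0.
have := s0; have := zcoord_lift_point (p (inZp i)).
have := zcoord_lift_point (p (inZp i.+2)); rewrite /zcoord /L.
rewrite det3E uz !lift_point0 !lift_point1 => -> -> s0'.
by field; rewrite o0 s0'.
Qed.

Lemma balanced_d_vec : balanced n phi X <-> d_vec p = 0.
Proof.
have ze k : k != ord_max -> zcoord (delta_mx 0 k : 'rV[R]_3) = 0.
  by move=> kn; rewrite /zcoord !mxE eq_sym (negPf kn).
have s02 : s / 2 != 0 by rewrite mulf_neq0 ?s0 // invr_neq0 // pnatr_eq0.
rewrite balanced_zcoord; split=> [[c h]|d0].
  apply/rowP => j; rewrite !mxE.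
  have h0 := glick_form_infinity (ze 0 isT).
  have h1 := glick_form_infinity (ze 1 isT).
  move: h0 h1; rewrite !h !ze // !mulr0 !mxE /= !mul1r !mul0r subr0 sub0r.
  move=> /esym/eqP; rewrite mulf_eq0 (negPf s02) /= => /eqP e1.
  move=> /esym/eqP; rewrite mulf_eq0 (negPf s02) /= oppr_eq0 => /eqP e0.
  by case: j => [[|[|//]] hj]; [rewrite -[RHS]e0 | rewrite -[RHS]e1];
    congr (d_vec p 0 _); apply: val_inj.
(* A form vanishing at infinity is its value at [e] times [zcoord]. *)
pose e : 'rV[R]_3 := delta_mx 0 ord_max.
have ez : zcoord e = 1 by rewrite /zcoord !mxE eqxx.
exists (g e) => u.
have lg : scalar g by apply: glick_form_scalar.
have : g (1 *: u - zcoord u *: e) = 0.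
  rewrite glick_form_infinity ?d0 ?mxE ?mulr0 ?subr0 ?mulr0 //.
  by rewrite (scalar_formB (@zcoord_scalar R)) ez mul1r mulr1 subrr.
by rewrite (scalar_formB lg) mul1r => /eqP; rewrite subr_eq0 mulrC => /eqP.
Qed.

Lemma phi_phi u w : phi u * phi w = zcoord u * zcoord w.
Proof. by rewrite /phi mulrACA s2 mul1r. Qed.

Lemma iterates_convex :
  (forall k, (1 <= k)%N ->
     convex_in_affine_plane
       (iter k (@inv_pentagram R n) (fun i => affine_point (p i))))
  <-> balanced n phi X.
Proof.
have cX := convex_seq_lift; have [perX posX _] := cX.
have convexE m : convex_in_affine_plane
      (iter m (@inv_pentagram R n) (fun i => affine_point (p i)))
    <-> forall k l, 0 < phi (iter m (@pentagram R) X k)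
                        * phi (iter m (@pentagram R) X l).
  have [perT posT] := iter_pentagram m perX posX.
  pose Y k := iter m (@pentagram R) X (k + m * n')%N.
  rewrite (@convex_in_affine_planeE _ Y).
  - have TY k : iter m (@pentagram R) X k = Y (k + m)%N.
      by rewrite /Y -addnA -mulnS periodicM.
    split=> h k l; last by rewrite -phi_phi h.
    by rewrite phi_phi !TY h.
  - exact: periodic_shift.
  - exact: positive_shift.
  - move=> k; apply: iter_inv_pentagram => // l.
    by rewrite /X vlineZ.
split=> [h|bal m _]; last first.
  have [] : convex_seq n phi (iter m (@pentagram R) X)
            /\ balanced n phi (iter m (@pentagram R) X).
    elim: m => [//|m [cT bT]]; split; first exact: convex_seq_pentagram.
    exact: balanced_pentagram.
  by case=> _ _ phiT _; apply/convexE => k l; rewrite mulr_gt0.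
apply: all_convex_balanced => //; elim=> [//|m cT].
have [perT posT] := iter_pentagram m.+1 perX posX; split=> // k.
(* Convexity only gives a common sign of [phi]; one positive vertex settles which. *)
have [i phii] := exists_phi_pentagram_gt0 n5 lphi cT.
by have := (convexE m.+1).1 (h m.+1 isT) i k; rewrite pmulr_rgt0.
Qed.

End ConvexPolygon.
End Correspondence.

Theorem theorem1p1 (R : realType) (n : nat) (p : 'I_n -> 'rV[R]_2)
    (v : 'I_n -> 'rV[R]_3) :
  (5 <= n)%N ->
  convex_polygon p ->
  (forall i, <[v i]>%VS = affine_point (p i)) ->
  [<-> forall k, (1 <= k)%N ->
         convex_in_affine_plane
           (iter k (@inv_pentagram R n) (fun i => affine_point (p i)));
       d_vec p = 0;
       affine_operator (glick v)].
Proof.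
case: n p v => [//|n'] p v n5 cp hv.
have [s s2 sp] := convex_polygon_sign n5 cp.
have E1 := iterates_convex n5 s2 sp; have E2 := balanced_d_vec n5 s2 sp.
have E3 := balanced_affine n5 s2 sp hv.
by tfae; rewrite ?E1 -?E2 -?E3.
Qed.
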